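(* Let $n\ge1$, $\theta^i\in\mathbb{R}$, $\sigma^i>0$ and $\tau^i=1/(\sigma^i)^2$ for $i=1,\dots,n$. Let $\{\mathcal{G}_k\}_{k\ge 0}$ be a $B$-strongly connected sequence of directed graphs on $\{1,\dots,n\}$ with associated weight matrices $A_k$. Assume the observations satisfy $S_k^i\sim\mathcal{N}(\theta^i,(\sigma^i)^2)$ for all $i$ and $k\ge1$ and are independent, and that the likelihood models are $\ell^i(\cdot|\theta)=\mathcal{N}(\theta,(\sigma^i)^2)$ for all $i$. Let $\theta_k^i$ be generated, from initial values $\theta_0^i\in\mathbb{R}$ and $\tau_0^i=\tau^i$, by $$\tau_{k+1}^i=\sum_{j=1}^n[A_k]_{ij}\tau_k^j+\tau^i,\qquad \theta_{k+1}^i=\frac{\sum_{j=1}^n[A_k]_{ij}\tau_k^j\theta_k^j+S_{k+1}^i\tau^i}{\tau_{k+1}^i},\qquad k\ge 0.$$ Then for every $i$, $$\lim_{k\to\infty}\theta_k^i=\theta^*\quad\text{almost surely},\qquad\text{where}\quad \theta^*=\frac{\sum_{i=1}^n\theta^i/(\sigma^i)^2}{\sum_{j=1}^n1/(\sigma^j)^2}.$$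
   Context: Superscripts index agents $i,j\in\{1,\dots,n\}$ and subscripts $k$ index time; $(\sigma^i)^2$ is the square of the number $\sigma^i$ attached to agent $i$. $\mathcal{N}(\theta,\sigma^2)$ denotes the Gaussian distribution (or its density) with mean $\theta$ and variance $\sigma^2$. The random variables $S_k^i$, $1\le i\le n$, $k\ge1$, are mutually independent. The initial values $\theta_0^i$ are deterministic. The likelihood models $\ell^i$ enter the algorithm only through the precisions $\tau^i$. The point $\theta^*$ is the unique minimizer over $\theta\in\mathbb{R}$ of $\sum_{i=1}^n\frac{(\theta-\theta^i)^2}{2(\sigma^i)^2}$. Communication: $\mathcal{G}_k=(\{1,\dots,n\},E_k)$ is the directed graph at time $k\ge0$, where $(j,i)\in E_k$ with $j\neq i$ means agent $j$ can communicate with agent $i$ at time $k$. $d_k^j$ is the out-degree of node $j$ at time $k$ (the number of $i\neq j$ with $(j,i)\in E_k$). The matrix $A_k$ is defined by $[A_k]_{ij}=\frac{1}{d_k^j+1}$ if $(j,i)\in E_k$ or $i=j$, and $[A_k]_{ij}=0$ otherwise; thus $A_k$ is column stochastic with positive diagonal entries. The graph sequence is called $B$-strongly connected if $B\ge1$ is an integer such that the graph $\left(\{1,\dots,n\},\bigcup_{t=kB}^{(k+1)B-1}E_t\right)$ is strongly connected for every $k\ge0$. *)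

(* Defs.v *)
From HB Require Import structures.
From mathcomp Require Import all_boot all_order all_algebra finmap.
From mathcomp Require Import all_classical all_reals all_analysis.

Set Implicit Arguments.
Unset Strict Implicit.
Unset Printing Implicit Defensive.

Import Order.TTheory GRing.Theory Num.Theory.
Import numFieldNormedType.Exports.

Local Open Scope classical_set_scope.
Local Open Scope ring_scope.

(* A sequence of directed graphs on {1, .., n} is a sequence of edge relations:
   [E k j i] means (j, i) \in E_k, i.e. j can communicate with i at time k.
   Self-loops carry no information: every definition below ignores whether
   [E k j j] holds. *)

Definition out_degree (n : nat) (e : rel 'I_n) (j : 'I_n) : nat :=
  #|[set i : 'I_n | (i != j) && e j i]%SET|.

Definition weight_mx (R : realType) (n : nat) (e : rel 'I_n) : 'M[R]_n :=
  \matrix_(i, j) if e j i || (i == j) then 1 / (out_degree e j + 1)%:R else 0.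

Definition strongly_connected (n : nat) (e : rel 'I_n) : Prop :=
  forall u v : 'I_n, connect e u v.

(* The t-th edge relation of the k-th window is at time k * B + t, t < B. *)
Definition B_strongly_connected (n B : nat) (E : nat -> rel 'I_n) : Prop :=
  (1 <= B)%N /\
  forall k : nat,
    strongly_connected [rel u v | [exists t : 'I_B, E (k * B + t)%N u v]].

Definition mutually_independent (d : measure_display) (T : measurableType d)
    (R : realType) (P : probability T R) (I : choiceType) (D : set I)
    (X : I -> {RV P >-> R}) : Prop :=
  forall (J : {fset I}) (C : I -> set R),
    [set` J] `<=` D ->
    (forall i, i \in J -> measurable (C i)) ->
    P (\bigcap_(i in [set` J]) (X i @^-1` C i)) =
      (\prod_(i <- enum_fset J) P (X i @^-1` C i))%E.

(* [s] is the standard deviation, not the variance. *)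
Definition has_normal_law (d : measure_display) (T : measurableType d)
    (R : realType) (P : probability T R) (X : {RV P >-> R}) (m s : R) : Prop :=
  forall C : set R, measurable C -> distribution P X C = normal_prob m s C.

Fixpoint precision (R : realType) (n : nat) (A : nat -> 'M[R]_n)
    (tau : 'I_n -> R) (k : nat) (i : 'I_n) : R :=
  if k is k'.+1 then \sum_(j < n) A k' i j * precision A tau k' j + tau i
  else tau i.

(* [s k i] is the observation of agent i at time k; [s 0] is never used. *)
Fixpoint estimate (R : realType) (n : nat) (A : nat -> 'M[R]_n)
    (tau theta0 : 'I_n -> R) (s : nat -> 'I_n -> R) (k : nat) (i : 'I_n) : R :=
  if k is k'.+1 then
    (\sum_(j < n) A k' i j * precision A tau k' j * estimate A tau theta0 s k' j
       + s k'.+1 i * tau i) / precision A tau k'.+1 i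
  else theta0 i.

Definition is_unique_minimizer (R : realType) (f : R -> R) (x : R) : Prop :=
  [set y | forall z, f y <= f z] = [set x].

(* Main.v *)
Require Import Defs.
From HB Require Import structures.
From mathcomp Require Import all_boot all_order all_algebra finmap.
From mathcomp Require Import all_classical all_reals all_analysis.
From mathcomp Require Import measurable_realfun.
From mathcomp Require Import zify ring lra.

Set Implicit Arguments.
Unset Strict Implicit.
Unset Printing Implicit Defensive.

Import Order.TTheory GRing.Theory Num.Theory.
Import numFieldNormedType.Exports.

Local Open Scope classical_set_scope.
Local Open Scope ring_scope.

(** Write [p k i] for the precision and [y k i] for the estimate of agent [i] at
    time [k], and [A k] for the weight matrix. Multiplying the recursion for
    [y] by the precision removes the division: both the vector [p k] and, for
    the consensus value [x], the vector [p k i * (y k i - x)] are trajectories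
    of a linear recursion [z (k+1) = A k *m z k + u (k+1)] driven by a
    column-stochastic matrix ([precision_trajectory], [estimate_error]). For
    the precision the input is the constant vector [tau]; for the error it is
    [tau j * (S k j - x)], which splits into a drift
    [tau j * (theta j - x)], the noise [tau j * (S k j - theta j)], and a
    correction at time 0.

    Strong connectivity over windows of length [B] makes every product of
    [(n+1) * B] consecutive weight matrices entrywise at least
    [n ^ - ((n+1) * B)] ([transition_weight_mx_ge]). This has two consequences.
    The total mass injected in the precision grows linearly, and it is spread
    over all agents, so that each [p k i] grows at least linearly
    ([trajectory_ge_linear]). And the products contract the l1-norm on vectors
    of zero sum (the Dobrushin coefficient, [l1norm_mulmx_contract]); since [x] is
    exactly the value for which the drift has zero sum, the trajectory driven
    by the drift is bounded ([trajectory_zero_sum_bounded]).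

    The noise part at time [k] is a sum of [k * n] independent centered
    Gaussian variables with bounded coefficients, because products of
    column-stochastic matrices have entries in [0, 1]. No mixing is needed here:
    the Chernoff bound gives a tail [q ^ k] for the event that this sum exceeds
    [e * k], and the Borel-Cantelli lemma shows that the noise is almost surely
    [o(k)] ([centered_sum_lln]). Dividing by the linearly growing precision
    yields the convergence.

    The Chernoff bound rests on the factorization of expectations of products
    of functions of independent variables ([integral_prod_indep]) and on the
    Gaussian moment generating function ([normal_law_expR]). Both follow from
    one principle: an identity between integrals that holds for indicator
    functions extends to nonnegative measurable functions
    ([ge0_integral_transfer]). *)

(** * Integration against a density along a map *)

Section integral_transfer.
Context d d' (T : measurableType d) (Y : measurableType d') (R : realType).
Variables (mu : {measure set T -> \bar R}) (nu : {measure set Y -> \bar R}).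
Variables (A : set T) (X : T -> Y) (G : T -> R).
Hypotheses (mA : measurable A) (mX : measurable_fun setT X).
Hypotheses (mG : measurable_fun setT G) (G0 : forall x, 0 <= G x).
Hypothesis munu : forall C, measurable C ->
  (\int[mu]_(x in A `&` X @^-1` C) (G x)%:E = nu C)%E.

Import HBNNSimple.

Let transfer_nnsfun (h : {nnsfun Y >-> R}) :
  (\int[mu]_(x in A) (h (X x) * G x)%:E = \int[nu]_y (h y)%:E)%E.
Proof.
under eq_integral => x _.
  rewrite fimfunE EFinM -fsumEFin// ge0_mule_fsuml; last first.
    by move=> r; rewrite EFinM nnfun_muleindic_ge0.
  over.
under [RHS]eq_integral => y _ do rewrite fimfunE -fsumEFin//.
have mI r : measurable_fun setT (fun x => (\1_(h @^-1` [set r]) (X x) : R)).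
  by apply: (measurableT_comp _ mX).
rewrite ge0_integral_fsum//; last 2 first.
- move=> r; apply: emeasurable_funM; apply/measurable_EFinP.
    by apply: measurable_funTS; exact: measurable_funM.
  exact: measurable_funTS.
- move=> r x _; rewrite mule_ge0 ?lee_fin//.
  by have := nnfun_muleindic_ge0 h r (X x).
rewrite ge0_integral_fsum//; last 2 first.
- by move=> r; apply/measurable_EFinP; exact: measurable_funM.
- by move=> r x _; rewrite EFinM nnfun_muleindic_ge0.
apply: eq_fsbigr => r _.
rewrite integralZl_indic_nnsfun// integral_indic// setIT.
have [r0|r0] := ltP r 0.
  rewrite preimage_nnfun0// measure0 mule0 integral0_eq// => x _.
  by rewrite indic0 mulr0 mul0e.
under eq_integral => x _ do rewrite EFinM -muleA.
rewrite ge0_integralZl//; last 2 first.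
- by apply: measurable_funTS; apply/measurable_EFinP; exact: measurable_funM.
- by move=> x _; rewrite -EFinM lee_fin mulr_ge0.
rewrite -munu; last exact: measurable_funPTI.
congr (_ * _)%E; rewrite integral_mkcondr; apply: eq_integral => x _.
by rewrite epatch_indic muleC /= !indicE.
Qed.

(** If the measure with density [G] restricted to [A] is pushed by [X] to [nu],
    then integrals of nonnegative functions agree. With [X] a random variable
    and [G] a function of other variables this expresses independence; with
    [X] the identity it turns a law given by a density into an integral. *)
Lemma ge0_integral_transfer (f : Y -> R) :
    measurable_fun setT f -> (forall y, 0 <= f y) ->
  (\int[mu]_(x in A) (f (X x) * G x)%:E = \int[nu]_y (f y)%:E)%E.
Proof.
move=> mf f0.
have mEf : measurable_fun setT (EFin \o f) by exact/measurable_EFinP.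
pose h := nnsfun_approx measurableT mEf.
have cvh y : (h n y)%:E @[n --> \oo] --> (f y)%:E.
  by apply: (@cvg_nnsfun_approx _ _ _ _ measurableT _ mEf) => // z _; rewrite lee_fin.
have ndh y m n : (m <= n)%N -> h m y <= h n y.
  by move=> mn; exact/lefP/nd_nnsfun_approx.
have H1 : (\int[mu]_(x in A) (h n (X x) * G x)%:E @[n --> \oo] -->
    \int[mu]_(x in A) (f (X x) * G x)%:E)%E.
  have -> : (\int[mu]_(x in A) (f (X x) * G x)%:E =
      \int[mu]_(x in A) limn (fun n => (h n (X x) * G x)%:E))%E.
    apply: eq_integral => x _; apply/esym/cvg_lim => //.
    under eq_fun do rewrite EFinM.
    by rewrite EFinM; apply: cvgeZr.
  apply: cvg_monotone_convergence => //.
  - move=> n; apply: measurable_funTS; apply/measurable_EFinP.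
    by apply: measurable_funM => //; exact: measurableT_comp.
  - by move=> n x _; rewrite lee_fin mulr_ge0.
  - by move=> x _ m n mn; rewrite lee_fin ler_wpM2r// ndh.
have H2 : (\int[nu]_x (h n x)%:E @[n --> \oo] --> \int[nu]_x (f x)%:E)%E.
  have -> : (\int[nu]_x (f x)%:E = \int[nu]_x limn (fun n => (h n x)%:E))%E.
    by apply: eq_integral => x _; apply/esym/cvg_lim.
  apply: cvg_monotone_convergence => //.
  - by move=> n; exact/measurable_EFinP.
  - by move=> n x _; rewrite lee_fin.
  - by move=> x _ m n mn; rewrite lee_fin ndh.
move: H1; under eq_fun do rewrite transfer_nnsfun.
by move=> H1; apply: (cvg_unique _ H1 H2).
Qed.

End integral_transfer.

(** * Expectations of products of independent variables *)

Section independence.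
Context d (T : measurableType d) (R : realType) (P : probability T R).
Variables (I : choiceType) (D : set I) (X : I -> {RV P >-> R}).
Hypothesis indepX : mutually_independent D X.

Lemma mutually_independent_seq (s : seq I) (C : I -> set R) :
    uniq s -> (forall i, i \in s -> D i) ->
    (forall i, i \in s -> measurable (C i)) ->
  (P (\bigcap_(i in [set` s]) (X i @^-1` C i)) =
   \prod_(i <- s) P (X i @^-1` C i))%E.
Proof.
move=> us sD mC; pose J := [fset i in s]%fset.
have Js : perm_eq (enum_fset J) s.
  by apply: uniq_perm => // i; rewrite inE.
have memJ i : (i \in J) = (i \in s) by rewrite inE.
rewrite -(perm_big _ Js) -indepX.
- by congr (P (\bigcap_(i in _) _)); apply/seteqP; split => i; rewrite /= memJ.
- by move=> i /=; rewrite memJ => /sD.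
- by move=> i; rewrite memJ => /mC.
Qed.

Variables (f : I -> R -> R) (e : I -> R).
Hypotheses (mf : forall i, measurable_fun setT (f i)).
Hypotheses (f0 : forall i x, 0 <= f i x).
Hypothesis fe : forall i, D i -> (\int[P]_w (f i (X i w))%:E = (e i)%:E)%E.

Let e0 i : D i -> 0 <= e i.
Proof. by move=> Di; rewrite -lee_fin -fe// integral_ge0// => w _; rewrite lee_fin. Qed.

(* The functions [f i] replace the indicators of the [C i] one index at a time:
   the list [s] holds the indices already replaced, [s'] the others. *)
Let integral_prod_indep_restr (s s' : seq I) (C : I -> set R) :
    uniq (s ++ s') -> (forall i, i \in s ++ s' -> D i) ->
    (forall i, measurable (C i)) ->
  (\int[P]_(w in \bigcap_(i in [set` s']) (X i @^-1` C i))
     (\prod_(i <- s) f i (X i w))%:E =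
   (\prod_(i <- s) e i)%:E * \prod_(i <- s') P (X i @^-1` C i))%E.
Proof.
have mXC C' i : measurable (C' i) -> measurable (X i @^-1` C' i).
  by move=> mC; exact: measurable_funPTI.
elim: s s' C => [|p s IHs] s' C us sD mC.
  under eq_integral => w _ do rewrite big_nil.
  rewrite big_nil integral_cst ?mul1e.
    by apply: mutually_independent_seq => // i /sD.
  by apply: fin_bigcap_measurable => // i _; exact: mXC.
have Dp : D p by apply: sD; rewrite mem_head.
pose A := \bigcap_(i in [set` s']) (X i @^-1` C i).
have mA : measurable A.
  by apply: fin_bigcap_measurable => // i _; exact: mXC.
pose k := \prod_(i <- s) e i * fine (\prod_(i <- s') P (X i @^-1` C i))%E.
have k0 : 0 <= k.
  rewrite mulr_ge0 ?fine_ge0 ?prode_ge0// big_seq prodr_ge0// => i si.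
  by apply: e0; apply: sD; rewrite inE mem_cat si orbT.
have kE : (k%:E = (\prod_(i <- s) e i)%:E * \prod_(i <- s') P (X i @^-1` C i))%E.
  rewrite EFinM fineK// prode_fin_num// => i _; rewrite fin_num_measure//.
  exact: mXC.
under eq_integral => w _ do rewrite big_cons.
rewrite (@ge0_integral_transfer _ _ _ _ _ _
  (mscale (NngNum k0) (distribution P (X p)))) //; last 3 first.
- by apply: measurable_prod => i _; exact: measurableT_comp.
- by move=> w; rewrite prodr_ge0.
- move=> C0 mC0; pose C' i := if i == p then C0 else C i.
  have mC' i : measurable (C' i) by rewrite /C'; case: ifP.
  have := IHs (p :: s') C'; rewrite /= in us.
  have ps' : p \notin s'.
    by move: us => /andP[]; rewrite mem_cat negb_or => /andP[].
  have C's' i : i \in s' -> C' i = C i.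
    by rewrite /C'; case: eqP => // ->; rewrite (negbTE ps').
  have -> : \bigcap_(i in [set` p :: s']) (X i @^-1` C' i) = A `&` X p @^-1` C0.
    have -> : [set` p :: s'] = p |` [set` s'].
      apply/seteqP; split => i /=; rewrite inE; first by case/orP => [/eqP|]; [left|right].
      by case=> [->|->]; rewrite ?eqxx ?orbT.
    rewrite bigcap_setU1 setIC {2}/C' eqxx; congr (_ `&` _).
    by apply: eq_bigcapr => i /= /C's' ->.
  move=> ->//.
  + rewrite big_cons {1}/C' eqxx muleCA muleC.
    rewrite [RHS](_ : _ = k%:E * P (X p @^-1` C0))%E// kE; congr (_ * _ * _)%E.
    by rewrite !big_seq; apply: eq_bigr => i /C's' ->.
  + by rewrite -cat1s uniq_catCA.
  + move=> i; rewrite mem_cat inE orbCA => h; apply: sD.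
    by rewrite inE mem_cat.
have mEf : measurable_fun setT (fun x => (f p x)%:E) by exact/measurable_EFinP.
rewrite ge0_integral_mscale => [|//|//|x _]; last by rewrite lee_fin.
rewrite ge0_integral_distribution => [|//|x]; last by rewrite lee_fin.
rewrite [in X in (_ * X)%E]/comp fe// big_cons.
rewrite [LHS](_ : _ = k%:E * (e p)%:E)%E// kE EFinM.
by rewrite muleC muleA.
Qed.

Lemma integral_prod_indep (s : seq I) :
    uniq s -> (forall i, i \in s -> D i) ->
  (\int[P]_w (\prod_(i <- s) f i (X i w))%:E = (\prod_(i <- s) e i)%:E)%E.
Proof.
move=> us sD; have := @integral_prod_indep_restr s [::] (fun=> setT).
rewrite cats0 big_nil mule1 => <-//; congr (integral _ _ _).
by apply/seteqP; split=> // w _ i.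
Qed.

End independence.

(** * Gaussian tails *)

Lemma integral_expR_normal_pdf (R : realType) (m s t : R) : s != 0 ->
  (\int[lebesgue_measure]_x (expR (t * (x - m)) * normal_pdf m s x)%:E =
   (expR (t ^+ 2 * s ^+ 2 / 2))%:E)%E.
Proof.
move=> s0.
(* Completing the square: the weight [expR (t * (x - m))] only shifts the
   mean of the density by [t * s ^+ 2]. *)
transitivity (\int[lebesgue_measure]_x ((expR (t ^+ 2 * s ^+ 2 / 2))%:E *
    (normal_pdf (m + t * s ^+ 2) s x)%:E))%E.
  apply: eq_integral => x _; rewrite -EFinM !normal_pdfE//; congr EFin.
  rewrite mulrCA [RHS]mulrCA; congr (_ * _).
  rewrite /normal_fun -!expRD; congr expR.
  by field.
rewrite integralZl//; last exact: integrable_normal_pdf.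
by rewrite integral_normal_pdf mule1.
Qed.

Lemma normal_law_expR d (T : measurableType d) (R : realType)
    (P : probability T R) (X : {RV P >-> R}) (m s t : R) :
  s != 0 -> has_normal_law X m s ->
  (\int[P]_w (expR (t * (X w - m)))%:E = (expR (t ^+ 2 * s ^+ 2 / 2))%:E)%E.
Proof.
move=> s0 hX; rewrite -(integral_expR_normal_pdf m t s0).
have mexp : measurable_fun setT (fun x : R => expR (t * (x - m))).
  by apply: measurableT_comp => //; apply: measurable_funM => //; exact: measurable_funB.
transitivity (\int[distribution P X]_x (expR (t * (x - m)))%:E)%E.
  by rewrite ge0_integral_distribution//; exact/measurable_EFinP.
(* The identity is used as a map between two copies of the line, whose Borel
   sigma-algebras coincide but are declared as distinct structures. *)
rewrite -(@ge0_integral_transfer _ _ _ _ _ (@lebesgue_measure R)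
  (distribution P X) setT id (normal_pdf m s))//.
- exact: measurable_normal_pdf.
- by move=> x; exact: normal_pdf_ge0.
- by move=> C mC; rewrite setTI; exact/esym/hX.
Qed.

Section gaussian_deviation.
Context d (T : measurableType d) (R : realType) (P : probability T R).
Variables (I : choiceType) (D : set I) (X : I -> {RV P >-> R}).
Hypothesis indepX : mutually_independent D X.
Variables (m s : I -> R).
Hypothesis s_neq0 : forall i, s i != 0.
Hypothesis normalX : forall i, D i -> has_normal_law (X i) (m i) (s i).

(** The linear combination, with coefficients [c], of the variables indexed by
    [l], each centered at its mean. *)
Definition centered_sum (l : seq I) (c : I -> R) (w : T) : R :=
  \sum_(i <- l) c i * (X i w - m i).

Lemma measurable_centered_sum l c : measurable_fun setT (centered_sum l c).
Proof.
apply: measurable_sum => i; apply: measurable_funM => //.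
exact: measurable_funB.
Qed.

Lemma centered_sum_tail (l : seq I) (c : I -> R) (V a : R) :
    uniq l -> (forall i, i \in l -> D i) ->
    0 < V -> \sum_(i <- l) c i ^+ 2 * s i ^+ 2 <= V -> 0 < a ->
  (P [set w | (a <= centered_sum l c w)%R] <= (expR (- (a ^+ 2 / (2 * V))))%:E)%E.
Proof.
move=> ul lD V0 cV a0.
pose Z : {mfun T >-> R} := HB.pack (centered_sum l c)
  (isMeasurableFun.Build _ _ _ _ (centered_sum l c) (measurable_centered_sum l c)).
(* The parameter minimizing [t ^+ 2 * V / 2 - t * a]. *)
pose t := a / V.
have t0 : 0 < t by exact: divr_gt0.
have := @chernoff _ _ _ P Z t a t0; move/le_trans; apply.
have -> : 'M_P Z t = (\prod_(i <- l) expR ((t * c i) ^+ 2 * s i ^+ 2 / 2))%:E.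
  pose f i x := expR (t * c i * (x - m i)).
  rewrite -(@integral_prod_indep _ _ _ P _ D X indepX f)//.
  - rewrite /mmt_gen_fun unlock; apply: eq_integral => w _ /=; congr EFin.
    rewrite -expR_sum; congr expR.
    by rewrite mulr_suml; apply: eq_bigr => i _; ring.
  - move=> i; apply: measurableT_comp => //; apply: measurable_funM => //.
    exact: measurable_funB.
  - by move=> i x; exact: expR_ge0.
  - by move=> i Di; apply: normal_law_expR => //; exact: normalX.
rewrite -expR_sum -EFinM -expRD lee_fin ler_expR.
apply: (@le_trans _ _ (t ^+ 2 / 2 * V - t * a)).
  rewrite lerD2r (_ : \sum_(i <- l) _ =
    t ^+ 2 / 2 * \sum_(i <- l) c i ^+ 2 * s i ^+ 2).
    by rewrite ler_wpM2l// divr_ge0// sqr_ge0.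
  by rewrite mulr_sumr; apply: eq_bigr => i _; ring.
rewrite le_eqVlt; apply/orP; left; apply/eqP.
by rewrite /t; field; exact: lt0r_neq0.
Qed.

End gaussian_deviation.

Lemma borel_cantelli_geometric d (T : measurableType d) (R : realType)
    (P : probability T R) (F : (set T)^nat) (q : R) :
    0 <= q < 1 -> (forall k, measurable (F k)) ->
    (forall k, P (F k) <= (q ^+ k)%:E)%E ->
  {ae P, forall w, \forall k \near \oo, ~ F k w}.
Proof.
move=> /andP[q0 q1] mF PF.
have mlim : measurable (lim_sup_set F).
  by apply: bigcap_measurable => // k _; exact: bigcup_measurable.
exists (lim_sup_set F); split => //.
- apply: lim_sup_set_cvg0 => //.
  apply: (@le_lt_trans _ _ (\sum_(k <oo) (q ^+ k)%:E)%E).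
    by apply: lee_nneseries => // k _; exact: PF.
  have -> : (\sum_(k <oo) (q ^+ k)%:E = ((1 - q)^-1)%:E)%E.
    apply/cvg_lim => //; under eq_fun do rewrite sumEFin.
    apply: cvg_EFin; first by apply: nearW.
    have := @cvg_geometric_series R 1 q; rewrite ger0_norm// => /(_ q1).
    rewrite mul1r; apply: cvg_trans; apply: near_eq_cvg; apply: nearW => n /=.
    by apply: eq_bigr => k _; rewrite /geometric /= mul1r.
  exact: ltry.
- move=> w /= nw k _; apply: contrapT => nk; apply: nw; exists k => // j /= kj Fj.
  by apply: nk; exists j.
Qed.

(** * Law of large numbers for weighted Gaussian sums *)

Section gaussian_lln.
Context d (T : measurableType d) (R : realType) (P : probability T R).
Variables (I : choiceType) (D : set I) (X : I -> {RV P >-> R}).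
Hypothesis indepX : mutually_independent D X.
Variables (m s : I -> R).
Hypothesis s_neq0 : forall i, s i != 0.
Hypothesis normalX : forall i, D i -> has_normal_law (X i) (m i) (s i).
Variables (l : nat -> seq I) (V : R).
Hypotheses (ul : forall k, uniq (l k)) (lD : forall k i, i \in l k -> D i).
Hypothesis V0 : 0 < V.

Let centered_sum_ub (c : nat -> I -> R) (e : R) :
    (forall k, \sum_(i <- l k) c k i ^+ 2 * s i ^+ 2 <= V * k%:R) -> 0 < e ->
  {ae P, forall w, \forall k \near \oo, centered_sum X m (l k) (c k) w < e * k%:R}.
Proof.
move=> cV e0; pose q := expR (- (e ^+ 2 / (2 * V))).
have q01 : 0 <= q < 1.
  by rewrite expR_ge0 expR_lt1 oppr_lt0 divr_gt0 ?exprn_gt0 ?mulr_gt0.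
(* Indexing by [k.+1] keeps the threshold and the variance bound positive, as
   the tail bound requires. *)
pose F k := [set w | e * k.+1%:R <= centered_sum X m (l k.+1) (c k.+1) w].
have mF k : measurable (F k).
  have mS := measurable_centered_sum X m (l k.+1) (c k.+1).
  have := mS measurableT `[e * k.+1%:R, +oo[%classic (measurable_itv _).
  rewrite setTI; congr measurable.
  by apply/seteqP; split => w /=; rewrite /F /= in_itv /= andbT.
have PF k : (P (F k) <= (q ^+ k)%:E)%E.
  apply: (le_trans (centered_sum_tail indepX s_neq0 normalX (ul k.+1)
    (@lD k.+1) _ (cV k.+1) _)); rewrite ?mulr_gt0 ?ltr0n// lee_fin.
  rewrite (_ : - _ = k.+1%:R * - (e ^+ 2 / (2 * V))); last first.
    by field; rewrite lt0r_neq0//= pnatr_eq0.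
  rewrite expRM_natl -/q exprS.
  by case/andP: q01 => q0 /ltW q1; rewrite ler_piMl// exprn_ge0.
have := borel_cantelli_geometric q01 mF PF.
apply: filterS => w [N _ hN]; exists N.+1 => // -[//|k] /= Nk.
by have /= := hN k Nk; rewrite /F /= => /negP; rewrite -ltNge.
Qed.

(** The weights may depend on [k] in an arbitrary way; only the linear growth of
    the variance matters. *)
Lemma centered_sum_lln (c : nat -> I -> R) :
    (forall k, \sum_(i <- l k) c k i ^+ 2 * s i ^+ 2 <= V * k%:R) ->
  {ae P, forall w, forall e, 0 < e ->
    \forall k \near \oo, `|centered_sum X m (l k) (c k) w| <= e * k%:R}.
Proof.
move=> cV.
have cVN k : \sum_(i <- l k) (- c k i) ^+ 2 * s i ^+ 2 <= V * k%:R.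
  by under eq_bigr do rewrite sqrrN.
have ae2 : {ae P, forall w, forall n : nat, \forall k \near \oo,
    `|centered_sum X m (l k) (c k) w| <= n.+1%:R^-1 * k%:R}.
  apply: ae_foralln => n.
  have e0 : (0 : R) < n.+1%:R^-1 by rewrite invr_gt0 ltr0n.
  apply: filterS2 (centered_sum_ub cV e0) (centered_sum_ub cVN e0) => w.
  apply: filterS2 => k h1 h2; rewrite ler_norml (ltW h1) andbT lerNl ltW//.
  move: h2; rewrite /centered_sum.
  by under eq_bigr do rewrite mulNr; rewrite sumrN.
apply: filterS ae2 => w h e e0.
have [n ne] : exists n : nat, n.+1%:R^-1 < e.
  exists (Num.truncn e^-1); rewrite invf_plt ?posrE ?ltr0n//.
  by rewrite truncnS_gt.
apply: filterS (h n) => k /le_trans; apply.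
by rewrite ler_wpM2r// ltW.
Qed.

End gaussian_lln.

(** * Column-stochastic matrices and linear recursions *)

Section column_stochastic.
Context (R : realFieldType) (n : nat).
Implicit Types (M : 'M[R]_n) (v : 'cV[R]_n).

(** Nonnegative entries, and every column sums to 1. *)
Definition column_stochastic M : Prop :=
  (forall i j, 0 <= M i j) /\ (forall j, \sum_i M i j = 1).

(** The l1-norm of a column vector. *)
Definition l1norm v : R := \sum_i `|v i 0|.

Lemma l1norm_ge0 v : 0 <= l1norm v.
Proof. exact: sumr_ge0. Qed.

Lemma ler_l1normD v1 v2 : l1norm (v1 + v2) <= l1norm v1 + l1norm v2.
Proof.
by rewrite /l1norm -big_split ler_sum// => i _; rewrite mxE ler_normD.
Qed.

Lemma ler_coord_l1norm v i : `|v i 0| <= l1norm v.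
Proof. by rewrite /l1norm (bigD1 i)//= lerDl sumr_ge0. Qed.

Lemma column_stochastic1 : column_stochastic 1%:M.
Proof.
split=> [i j|j]; first by rewrite mxE ler0n.
by rewrite (bigD1 j)//= mxE eqxx big1 ?addr0// => i /negbTE ij; rewrite mxE ij.
Qed.

Lemma sum_mulmx_column_stochastic M v : column_stochastic M ->
  \sum_i (M *m v) i 0 = \sum_i v i 0.
Proof.
move=> [_ M1]; under eq_bigr do rewrite mxE.
by rewrite exchange_big/=; apply: eq_bigr => j _; rewrite -mulr_suml M1 mul1r.
Qed.

Lemma column_stochasticM M1 M2 :
  column_stochastic M1 -> column_stochastic M2 -> column_stochastic (M1 *m M2).
Proof.
move=> M1s [M20 M2s]; split=> [i j|j].
  by rewrite mxE sumr_ge0// => k _; rewrite mulr_ge0// M1s.1.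
under eq_bigr do rewrite mxE.
rewrite exchange_big -[RHS](M2s j); apply: eq_bigr => k _.
by rewrite -mulr_suml M1s.2 mul1r.
Qed.

Lemma column_stochastic_le1 M i j : column_stochastic M -> M i j <= 1.
Proof. by case=> M0 /(_ j) <-; rewrite (bigD1 i)//= lerDl sumr_ge0. Qed.

Lemma l1norm_mulmx M v : column_stochastic M -> l1norm (M *m v) <= l1norm v.
Proof.
move=> [M0 M1]; rewrite /l1norm.
have -> : \sum_i `|v i 0| = \sum_i \sum_j M i j * `|v j 0|.
  by rewrite exchange_big; apply: eq_bigr => j _; rewrite -mulr_suml M1 mul1r.
apply: ler_sum => i _; rewrite mxE; apply: (le_trans (ler_norm_sum _ _ _)).
by apply: ler_sum => j _; rewrite normrM ger0_norm.
Qed.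

(** Subtracting [dlt] from all entries of [M] does not change the image of a
    vector of zero sum, and leaves a nonnegative matrix with column sums at most
    [1 - dlt]. *)
Lemma l1norm_mulmx_contract M v (dlt : R) : (0 < n)%N ->
    column_stochastic M -> (forall i j, dlt <= M i j) -> 0 <= dlt ->
    \sum_i v i 0 = 0 ->
  l1norm (M *m v) <= (1 - dlt) * l1norm v.
Proof.
move=> n0 [_ M1] Mdlt dlt0 v0; rewrite /l1norm.
apply: (@le_trans _ _ (\sum_i \sum_j (M i j - dlt) * `|v j 0|)).
  apply: ler_sum => i _; rewrite mxE.
  have -> : \sum_j M i j * v j 0 = \sum_j (M i j - dlt) * v j 0.
    under [RHS]eq_bigr do rewrite mulrBl.
    by rewrite sumrB -mulr_sumr v0 mulr0 subr0.
  apply: (le_trans (ler_norm_sum _ _ _)).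
  by apply: ler_sum => j _; rewrite normrM ger0_norm// subr_ge0.
rewrite exchange_big mulr_sumr; apply: ler_sum => j _ /=.
rewrite -mulr_suml ler_wpM2r// sumrB M1 lerD2l lerN2 sumr_const card_ord.
by rewrite -mulr_natl ler_peMl// ler1n.
Qed.

End column_stochastic.

Section linear_recursion.
Context (R : realFieldType) (n : nat) (A : nat -> 'M[R]_n).
Implicit Type u : nat -> 'cV[R]_n.

(** [transition s m] is the product of the [m] matrices [A s], ...,
    [A (s + m - 1)], the most recent one on the left. *)
Fixpoint transition (s m : nat) : 'M[R]_n :=
  if m is m'.+1 then A (s + m') *m transition s m' else 1%:M.

(** The solution of [z (k+1) = A k *m z k + u (k+1)] with [z 0 = u 0]: the input
    at time 0 is the initial value. *)
Fixpoint trajectory u (k : nat) : 'cV[R]_n :=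
  if k is k'.+1 then A k' *m trajectory u k' + u k else u 0%N.

Lemma trajectoryD u v k :
  trajectory (fun t => u t + v t) k = trajectory u k + trajectory v k.
Proof. by elim: k => [//|k IHk] /=; rewrite IHk mulmxDr addrACA. Qed.

Lemma eq_trajectory u v k : u =1 v -> trajectory u k = trajectory v k.
Proof. by move=> uv; elim: k => [|k IHk] /=; rewrite ?IHk uv. Qed.

Lemma trajectoryE u k :
  trajectory u k = \sum_(t < k.+1) transition t (k - t) *m u t.
Proof.
elim: k => [|k IHk] /=; first by rewrite big_ord1 mul1mx.
rewrite IHk [RHS]big_ord_recr /= subnn mul1mx mulmx_sumr; congr (_ + _).
apply: eq_bigr => t _; have tk : (t <= k)%N by rewrite -ltnS.
by rewrite subSn//= mulmxA subnKC.
Qed.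

Hypothesis A_stoch : forall k, column_stochastic (A k).

Lemma column_stochastic_transition s m : column_stochastic (transition s m).
Proof.
elim: m => [|m IHm] /=; first exact: column_stochastic1.
exact: column_stochasticM.
Qed.

Lemma sum_trajectory u k :
  \sum_i trajectory u k i 0 = \sum_(t < k.+1) \sum_i u t i 0.
Proof.
elim: k => [|k IHk] /=; first by rewrite big_ord1.
rewrite [RHS]big_ord_recr /= -IHk -(sum_mulmx_column_stochastic _ (A_stoch k)).
by rewrite -big_split; apply: eq_bigr => i _; rewrite mxE.
Qed.

Lemma trajectory_le_l1norm u b k m :
    (forall t, (0 < t)%N -> l1norm (u t) <= b) ->
  l1norm (trajectory u (k + m)) <=
  l1norm (transition k m *m trajectory u k) + m%:R * b.
Proof.
move=> ub.
suff [r rb ->] : exists2 r, l1norm r <= m%:R * b &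
    trajectory u (k + m) = transition k m *m trajectory u k + r.
  by apply: (le_trans (ler_l1normD _ _)); rewrite lerD2l.
elim: m => [|m [r rb rE]].
  exists 0; last by rewrite addn0 mul1mx addr0.
  by rewrite mul0r /l1norm big1// => i _; rewrite mxE normr0.
exists (A (k + m) *m r + u (k + m).+1).
  apply: (le_trans (ler_l1normD _ _)); rewrite -natr1 mulrDl mul1r lerD ?ub//.
  by apply: le_trans rb; exact: l1norm_mulmx.
by rewrite addnS /= rE mulmxDr mulmxA addrA.
Qed.

Lemma trajectory_ge u k m i : (forall t i, 0 <= u t i 0) ->
  (transition k m *m trajectory u k) i 0 <= trajectory u (k + m) i 0.
Proof.
move=> u0; elim: m i => [|m IHm] i; first by rewrite addn0 mul1mx.
rewrite addnS /= -mulmxA mxE [leRHS]mxE (_ : (A (k + m) *m _) i 0 =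
  \sum_j A (k + m)%N i j * trajectory u (k + m) j 0); last by rewrite mxE.
apply: ler_wpDr => //; apply: ler_sum => j _; rewrite ler_wpM2l//.
exact: (A_stoch _).1.
Qed.

Section mixing.
Hypothesis n_gt0 : (0 < n)%N.
Variables (m : nat) (dlt : R).
Hypotheses (m_gt0 : (0 < m)%N) (dlt_gt0 : 0 < dlt) (dlt_le1 : dlt <= 1).
Hypothesis transition_ge : forall s i j, dlt <= transition s m i j.

Lemma trajectory_zero_sum_bounded u b :
    (forall t, \sum_i u t i 0 = 0) -> (forall t, l1norm (u t) <= b) ->
  forall k, l1norm (trajectory u k) <= m.+1%:R * b / dlt.
Proof.
move=> u0 ub; have b0 : 0 <= b := le_trans (l1norm_ge0 _) (ub 0%N).
(* With [K] the claimed bound, one block of [m] steps maps a norm at most [K] to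
   at most [(1 - dlt) * K + m * b], which is at most [K]. *)
elim/ltn_ind => k IHk; have [km|mk] := ltnP k m.
  have := @trajectory_le_l1norm u b 0 k (fun t _ => ub t).
  rewrite add0n => /le_trans; apply.
  apply: (@le_trans _ _ (m.+1%:R * b)); last first.
    by rewrite ler_pdivlMr// ler_piMr// mulr_ge0.
  apply: (@le_trans _ _ (b + k%:R * b)).
    rewrite lerD2r; apply: le_trans (ub 0%N); apply: l1norm_mulmx.
    exact: column_stochastic_transition.
  rewrite -[X in X + _]mul1r -mulrDl ler_wpM2r// addrC natr1 ler_nat ltnS.
  exact: ltnW.
have kmk : (k - m < k)%N by rewrite ltn_subrL m_gt0 (leq_trans m_gt0 mk).
rewrite -(subnK mk); apply: (le_trans (trajectory_le_l1norm _ _ (fun t _ => ub t))).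
apply: (@le_trans _ _ ((1 - dlt) * (m.+1%:R * b / dlt) + m%:R * b)).
  rewrite lerD2r.
  apply: (@le_trans _ _ ((1 - dlt) * l1norm (trajectory u (k - m)))).
    apply: l1norm_mulmx_contract => //; first exact: column_stochastic_transition.
      exact: ltW.
    by rewrite sum_trajectory big1.
  by rewrite ler_wpM2l ?subr_ge0// IHk.
rewrite mulrBl mul1r [dlt * _]mulrC divfK ?lt0r_neq0// -natr1.
by rewrite mulrDl mul1r; lra.
Qed.

(** Under a constant nonnegative input [v], the total mass at time [k - m] is
    [(k - m + 1)] times that of [v], and the next [m] steps bring a fraction
    [dlt] of it to each coordinate. The factor [1 / (m + 1)] absorbs the
    difference between [k - m + 1] and [k]. *)
Lemma trajectory_ge_linear (v : 'cV[R]_n) k i : (forall i, 0 <= v i 0) ->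
    (m <= k)%N ->
  dlt * (\sum_i v i 0) / m.+1%:R * k%:R <= trajectory (fun=> v) k i 0.
Proof.
move=> v0 mk; have v0' := fun _ : nat => v0.
rewrite -[in leRHS](subnK mk).
apply: (le_trans _ (trajectory_ge (k - m) m i v0')).
have y0 j : 0 <= trajectory (fun=> v) (k - m) j 0.
  rewrite trajectoryE summxE sumr_ge0// => t _; rewrite mxE sumr_ge0// => l _.
  by rewrite mulr_ge0// (column_stochastic_transition _ _).1.
apply: (@le_trans _ _ (\sum_j dlt * trajectory (fun=> v) (k - m) j 0)); last first.
  by rewrite mxE ler_sum// => j _; rewrite ler_wpM2r.
rewrite -mulr_sumr sum_trajectory sumr_const card_ord -!mulrA.
apply: ler_wpM2l; first exact: ltW.
rewrite -[leRHS]mulr_natr ler_wpM2l ?sumr_ge0//.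
rewrite ler_pdivrMl ?ltr0n// -natrM ler_nat.
by rewrite -[leqLHS](subnKC mk) mulnS mulSn leq_add ?leq_addr.
Qed.

End mixing.
End linear_recursion.

(** * Positivity of products of weight matrices *)

Section weight_matrix.
Context (R : realType) (n : nat).
Implicit Type e : rel 'I_n.

Lemma column_stochastic_weight_mx e : column_stochastic (weight_mx R e).
Proof.
split=> [i j|j]; first by rewrite mxE; case: ifP => // _; rewrite divr_ge0 ?ler0n.
under eq_bigr do rewrite mxE.
rewrite (bigD1 j)//= eqxx orbT.
rewrite (eq_bigr (fun i => if e j i then 1 / (out_degree e j + 1)%:R else 0)); last first.
  by move=> i /negbTE ->; rewrite orbF.
rewrite -big_mkcondr sumr_const /=.
rewrite (_ : #|_| = out_degree e j); last first.
  by rewrite /out_degree cardsE.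
by rewrite -mulrS addn1 -[LHS]mulr_natr divfK// pnatr_eq0.
Qed.

Lemma weight_mx_ge e i j : e j i || (i == j) -> n%:R^-1 <= weight_mx R e i j.
Proof.
move=> eji; rewrite mxE eji div1r lef_pV2 ?posrE ?ltr0n ?addn1//; last first.
  by case: n i {e j eji} => [[]|].
rewrite ler_nat; apply: (@leq_trans #|[set~ j]%SET|.+1); last first.
  by rewrite cardsC1 card_ord prednK//; case: n i {e j eji} => [[]|].
rewrite ltnS subset_leq_card//; apply/fintype.subsetP => k; rewrite !inE.
by case/andP.
Qed.

End weight_matrix.

Section reachability.
Context (n B : nat) (E : nat -> rel 'I_n).

(** The agents that information leaving [j] at time [s] can have reached after
    [m] steps, when it may also stay in place. *)
Fixpoint reached (j : 'I_n) (s m : nat) : {set 'I_n} :=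
  if m is m'.+1 then
    [set i | [exists u in reached j s m', E (s + m')%N u i || (i == u)]]%SET
  else [set j]%SET.

Lemma reached_subset j s m1 m2 : (m1 <= m2)%N ->
  reached j s m1 \subset reached j s m2.
Proof.
move=> /subnKC <-; elim: (m2 - m1)%N => [|m IHm]; first by rewrite addn0.
apply: (fintype.subset_trans IHm); rewrite addnS /=; apply/fintype.subsetP => i ri.
by rewrite inE; apply/existsP; exists i; rewrite ri eqxx orbT.
Qed.

Lemma mem_reached j s m : j \in reached j s m.
Proof. by apply: (fintype.subsetP (reached_subset j s (leq0n m))); rewrite inE. Qed.

Hypothesis EB : B_strongly_connected B E.

(** If a full window starting at time [q * B] adds no agent, then the reached
    set is closed under the edges of the union graph of this window, hence it is
    everything. *)
Lemma reached_window j s q : (s <= q * B)%N ->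
  reached j s (q * B - s + B) = reached j s (q * B - s) ->
  reached j s (q * B - s) = [set: 'I_n]%SET.
Proof.
move=> sq Qst; set m := (q * B - s)%N in Qst *; set Q := reached j s m in Qst *.
have QE t : (t <= B)%N -> reached j s (m + t) = Q.
  move=> tB; apply/eqP; rewrite finset.eqEsubset (reached_subset _ _ (leq_addr _ _)).
  by rewrite -Qst reached_subset// leq_add2l.
have Qclosed u v : u \in Q -> [exists t : 'I_B, E (q * B + t)%N u v] -> v \in Q.
  move=> uQ /existsP[t tuv]; rewrite -(QE t.+1)// addnS /= inE.
  apply/existsP; exists u; rewrite QE ?uQ ?(ltnW (ltn_ord t))//=.
  by rewrite addnA subnKC// tuv.
apply/setP => v; rewrite inE; have [p pp ->] := connectP (EB.2 q j v).
have : j \in Q by exact: mem_reached.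
elim: p (j) pp => [|u p IHp] v' //= /andP[v'u pp] v'Q.
exact/IHp/(Qclosed _ _ v'Q v'u).
Qed.

(** At most [B] steps lead from [s] to the beginning of a window, and each of the
    next [n] windows adds an agent as long as one is missing. *)
Lemma reached_full j s m : (n.+1 * B <= m)%N -> reached j s m = [set: 'I_n]%SET.
Proof.
move=> hm; have B_gt0 := EB.1.
pose q := (s %/ B).+1.
have sq : (s <= q * B)%N by rewrite ltnW// ltn_ceil.
have qs : (q * B - s <= B)%N by rewrite /q mulSn; have := leq_divM s B; lia.
pose Q r := reached j s (q * B - s + r * B).
have Qgrow r : Q r = [set: 'I_n]%SET \/ (r < #|Q r|)%N.
  elim: r => [|r [Qr|Qr]].
  - by right; apply/card_gt0P; exists j; exact: mem_reached.
  - left; apply/eqP; rewrite finset.eqEsubset finset.subsetT -Qr.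
    by rewrite reached_subset// leq_add2l leq_mul2r leqnSn orbT.
  have sub : Q r \subset Q r.+1.
    by rewrite reached_subset// leq_add2l leq_mul2r leqnSn orbT.
  have [QQ|QQ] := eqVneq (Q r.+1) (Q r).
    left; rewrite QQ.
    have sqr : (s <= (q + r) * B)%N by rewrite mulnDl (leq_trans sq)// leq_addr.
    have qrE : (q * B - s + r * B = (q + r) * B - s)%N.
      by rewrite mulnDl addnBAC.
    rewrite /Q qrE; apply: reached_window => //.
    by move: QQ; rewrite /Q mulSn [(B + _)%N]addnC addnA qrE.
  right; apply: (leq_ltn_trans Qr); apply: proper_card.
  by rewrite finset.properEneq eq_sym QQ sub.
have [QnT|] := Qgrow n; last first.
  by rewrite ltnNge -[X in (_ <= X)%N]card_ord max_card.
apply/eqP; rewrite finset.eqEsubset finset.subsetT -QnT reached_subset// (leq_trans _ hm)//.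
by rewrite mulSn leq_add2r.
Qed.

End reachability.

Lemma transition_weight_mx_ge (R : realType) (n B : nat) (E : nat -> rel 'I_n)
    (s : nat) (i j : 'I_n) : B_strongly_connected B E ->
  n%:R^-1 ^+ (n.+1 * B) <= transition (fun k => weight_mx R (E k)) s (n.+1 * B) i j.
Proof.
move=> EB.
suff H m i' : i' \in reached E j s m ->
    n%:R^-1 ^+ m <= transition (fun k => weight_mx R (E k)) s m i' j.
  by apply: H; rewrite (reached_full EB)// inE.
elim: m i' => [|m IHm] i' /=; first by rewrite inE mxE => /eqP ->; rewrite eqxx.
rewrite inE => /existsP[u /andP[ru Eu]].
rewrite mxE (bigD1 u)//= exprS -[leLHS]addr0 lerD//.
  by rewrite ler_pM ?exprn_ge0 ?invr_ge0 ?ler0n//; [exact: weight_mx_ge|exact: IHm].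
rewrite sumr_ge0// => k _; rewrite mulr_ge0//.
  exact: (column_stochastic_weight_mx R (E (s + m)%N)).1.
apply: (column_stochastic_transition _ _ _).1 => t.
exact: column_stochastic_weight_mx.
Qed.

(** * Weighted means, estimation errors and their limit *)

Lemma weighted_mean_unique_minimizer (R : realType) (n : nat)
    (a theta : 'I_n -> R) (mean : R) :
    0 < \sum_i a i -> \sum_i a i * (theta i - mean) = 0 ->
  is_unique_minimizer (fun x => \sum_i (x - theta i) ^+ 2 * a i) mean.
Proof.
move=> a0 meanE.
have fE x : \sum_i (x - theta i) ^+ 2 * a i =
    \sum_i (mean - theta i) ^+ 2 * a i + (x - mean) ^+ 2 * \sum_i a i.
  apply/eqP; rewrite -subr_eq0 mulr_sumr -big_split -sumrB /=; apply/eqP.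
  transitivity (\sum_i (-2 * (x - mean)) * (a i * (theta i - mean))).
    by apply: eq_bigr => i _; ring.
  by rewrite -mulr_sumr meanE mulr0.
apply/seteqP; split=> [y /= /(_ mean)|y /= -> z]; rewrite [leRHS]fE; last first.
  by rewrite lerDl mulr_ge0 ?sqr_ge0// ltW.
rewrite fE subrr expr0n mul0r addr0 gerDl pmulr_lle0// => y0.
by apply/eqP; rewrite -subr_eq0 -sqrf_eq0 eq_le y0 sqr_ge0.
Qed.

Section estimate_error.
Context (R : realType) (n : nat) (A : nat -> 'M[R]_n) (tau theta0 : 'I_n -> R).
Hypotheses (A_stoch : forall k, column_stochastic (A k)).
Hypothesis tau_gt0 : forall i, 0 < tau i.

Lemma precision_trajectory k i :
  precision A tau k i = trajectory A (fun=> \col_j tau j) k i 0.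
Proof.
elim: k i => [|k IHk] i /=; first by rewrite mxE.
by rewrite !mxE; congr (_ + _); apply: eq_bigr => j _; rewrite IHk.
Qed.

Lemma precision_gt0 k i : 0 < precision A tau k i.
Proof.
elim: k i => [|k IHk] i //=; rewrite ltr_wpDl// sumr_ge0// => j _.
by apply: mulr_ge0; [exact: (A_stoch k).1|exact: ltW].
Qed.

(** The scaled error of the estimates follows a linear recursion, whatever the
    reference value [x]. *)
Lemma estimate_error (s : nat -> 'I_n -> R) (x : R) k i :
  precision A tau k i * (estimate A tau theta0 s k i - x) =
  trajectory A
    (fun t => \col_j (tau j * ((if t is 0%N then theta0 j else s t j) - x))) k i 0.
Proof.
elim: k i => [|k IHk] i; first by rewrite /= mxE.
have p0 : precision A tau k.+1 i != 0 by rewrite gt_eqF// precision_gt0.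
rewrite mulrBr [estimate _ _ _ _ _ _]/= [X in X - _]mulrC divfK// /= !mxE.
under [in RHS]eq_bigr do rewrite -IHk mulrBr mulrBr mulrA mulrA.
rewrite sumrB -mulr_suml; ring.
Qed.

End estimate_error.

(** The error [y k - x] is the quotient of [z k + N k], which is bounded up to a
    term [o(k)], by [p k], which grows at least linearly. *)
Lemma cvg_ratio_linear_growth (R : realType) (z p N : nat -> R) (K c x : R)
    (m : nat) (y : nat -> R) :
    (forall k, 0 < p k) -> 0 < c -> (forall k, (m <= k)%N -> c * k%:R <= p k) ->
    (forall k, p k * (y k - x) = z k + N k) -> (forall k, `|z k| <= K) ->
    (forall e, 0 < e -> \forall k \near \oo, `|N k| <= e * k%:R) ->
  y k @[k --> \oo] --> x.
Proof.
move=> p0 c0 cp pE zK hN; apply/cvgrPdist_le => e e0.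
pose e' := e * c / 2; have e'0 : 0 < e' by rewrite divr_gt0// mulr_gt0.
near=> k.
rewrite distrC -(ler_pM2l (p0 k)) -[X in X * _ <= _](gtr0_norm (p0 k)).
rewrite -normrM pE; apply: (le_trans (ler_normD _ _)).
apply: (@le_trans _ _ (c * k%:R * e)); last first.
  by rewrite ler_wpM2r ?(ltW e0)// cp//; near: k; exact: nbhs_infty_ge.
have -> : c * k%:R * e = e' * k%:R + e' * k%:R by rewrite /e'; field.
apply: lerD; last by near: k; exact: hN.
apply: (le_trans (zK k)); rewrite -ler_pdivrMl//.
by near: k; exact: nbhs_infty_ger.
Unshelve. all: by end_near. Qed.

Theorem theorem5 (R : realType) (d : measure_display) (T : measurableType d)
    (P : probability T R)
    (n : nat) (hn : (1 <= n)%N)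
    (theta sigma tau : 'I_n -> R)
    (sigma_gt0 : forall i, 0 < sigma i)
    (tauE : forall i, tau i = 1 / sigma i ^+ 2)
    (B : nat) (E : nat -> rel 'I_n)
    (hE : B_strongly_connected B E)
    (S : nat -> 'I_n -> {RV P >-> R})
    (S_normal : forall k i, (1 <= k)%N ->
      has_normal_law (S k i) (theta i) (sigma i))
    (S_indep : mutually_independent
      [set ki : nat * 'I_n | (1 <= ki.1)%N] (fun ki => S ki.1 ki.2))
    (ell : 'I_n -> R -> R -> R)
    (ellE : forall i x s, ell i x s = normal_pdf x (sigma i) s)
    (theta0 : 'I_n -> R) :
  let A := fun k => weight_mx R (E k) in
  let theta_ := fun k i w => estimate A tau theta0 (fun l j => S l j w) k i in
  let theta_star :=
    (\sum_(i < n) theta i / sigma i ^+ 2) / (\sum_(j < n) 1 / sigma j ^+ 2) in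
  is_unique_minimizer
    (fun x => \sum_(i < n) (x - theta i) ^+ 2 / (2 * sigma i ^+ 2)) theta_star
  /\
  forall i : 'I_n,
    {ae P, forall w, theta_ k i w @[k --> \oo] --> theta_star}.
Proof.
move=> A theta_ theta_star.
have tau_gt0 i : 0 < tau i by rewrite tauE divr_gt0// exprn_gt0.
pose Tau := \sum_i tau i.
have Tau_gt0 : 0 < Tau.
  rewrite /Tau (bigD1 (Ordinal hn))//= ltr_wpDr//.
  by rewrite sumr_ge0// => i _; rewrite ltW.
have meanE : \sum_i tau i * (theta i - theta_star) = 0.
  under eq_bigr do rewrite mulrBr.
  rewrite sumrB -mulr_suml -/Tau /theta_star.
  have -> : \sum_j 1 / sigma j ^+ 2 = Tau by apply: eq_bigr => j _; rewrite tauE.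
  have -> : \sum_i theta i / sigma i ^+ 2 = \sum_i tau i * theta i.
    by apply: eq_bigr => j _; rewrite tauE mulrC div1r.
  by rewrite mulrC divfK ?subrr// lt0r_neq0.
split.
  have -> : (fun x => \sum_(i < n) (x - theta i) ^+ 2 / (2 * sigma i ^+ 2)) =
      (fun x => \sum_(i < n) (x - theta i) ^+ 2 * (tau i / 2)).
    apply/funext => x; apply: eq_bigr => i _; rewrite tauE.
    by field; rewrite lt0r_neq0.
  apply: weighted_mean_unique_minimizer.
    by rewrite -mulr_suml divr_gt0.
  under eq_bigr do rewrite mulrAC.
  by rewrite -mulr_suml meanE mul0r.
move=> i.
have A_stoch k : column_stochastic (A k) by exact: column_stochastic_weight_mx.
pose m := (n.+1 * B)%N; pose dlt : R := n%:R^-1 ^+ m.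
have m_gt0 : (0 < m)%N by rewrite muln_gt0 hE.1.
have dlt_gt0 : 0 < dlt by rewrite exprn_gt0// invr_gt0 ltr0n.
have dlt_le1 : dlt <= 1 by rewrite exprn_ile1// ?invr_ge0// invf_le1 ?ltr0n ?ler1n.
have trans_ge s k j : dlt <= transition A s m k j by exact: transition_weight_mx_ge.
(* The input [tau j * (S t j - theta_star)] is split into a constant drift of
   zero sum and a centered noise; [init] accounts for the input at time 0, where
   [theta0] stands for the observation. *)
pose drift (t : nat) : 'cV[R]_n := \col_j (tau j * (theta j - theta_star)).
pose init (t : nat) : 'cV[R]_n :=
  \col_j (tau j * (if t is 0%N then theta0 j - theta j else 0)).
pose noise w (t : nat) : 'cV[R]_n :=
  \col_j (tau j * (if t is 0%N then 0 else S t j w - theta j)).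
have errorE w k : precision A tau k i * (theta_ k i w - theta_star) =
    trajectory A (fun t => drift t + init t) k i 0 + trajectory A (noise w) k i 0.
  rewrite /theta_ estimate_error//.
  transitivity (trajectory A (fun t => drift t + init t + noise w t) k i 0).
    congr (fun_of_matrix _ i 0); apply: eq_trajectory => t; apply/colP => j.
    by rewrite !mxE; case: t => [|t]; ring.
  by rewrite trajectoryD mxE.
pose K := m.+1%:R * l1norm (drift 0%N) / dlt + l1norm (init 0%N).
have driftK k : `|trajectory A (fun t => drift t + init t) k i 0| <= K.
  rewrite trajectoryD mxE; apply: (le_trans (ler_normD _ _)); apply: lerD.
    apply: (le_trans (ler_coord_l1norm _ _)).
    apply: (@trajectory_zero_sum_bounded _ _ A A_stoch hn m dlt) => // t.
    by under eq_bigr do rewrite mxE.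
  apply: (le_trans (ler_coord_l1norm _ _)).
  have := @trajectory_le_l1norm _ _ A A_stoch init 0 0 k.
  rewrite add0n mulr0 addr0 => /(_ _)/le_trans; apply.
    case=> // t _; rewrite /l1norm big1// => j _.
    by rewrite mxE mulr0 normr0.
  by apply: l1norm_mulmx; exact: column_stochastic_transition.
(* By [trajectoryE] the noise trajectory is a combination of the observations up
   to time [k], with coefficients [c k] independent of the outcome. *)
pose D := [set ki : nat * 'I_n | (1 <= ki.1)%N].
pose l k := [seq (t, j) | t <- iota 1 k, j <- enum 'I_n].
pose c k (tj : nat * 'I_n) := transition A tj.1 (k - tj.1) i tj.2 * tau tj.2.
have lE k (F : nat * 'I_n -> R) :
    \sum_(tj <- l k) F tj = \sum_(1 <= t < k.+1) \sum_j F (t, j).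
  rewrite big_allpairs /index_iota subSS subn0; apply: eq_bigr => t _.
  by rewrite big_enum.
have noiseE w k : trajectory A (noise w) k i 0 =
    centered_sum (fun ki => S ki.1 ki.2) (fun ki => theta ki.2) (l k) (c k) w.
  rewrite trajectoryE summxE /centered_sum lE.
  rewrite -(big_mkord xpredT (fun t => (transition A t (k - t) *m noise w t) i 0)).
  rewrite big_ltn// mxE big1 ?add0r; last by move=> j _; rewrite mxE !mulr0.
  rewrite big_nat [RHS]big_nat; apply: eq_bigr => -[//|t] _.
  by rewrite mxE; apply: eq_bigr => j _; rewrite mxE mulrA.
pose V := \sum_j tau j ^+ 2 * sigma j ^+ 2.
have V_gt0 : 0 < V.
  rewrite /V (bigD1 (Ordinal hn))//= ltr_wpDr ?mulr_gt0 ?exprn_gt0//.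
  by rewrite sumr_ge0// => j _; rewrite mulr_ge0 ?sqr_ge0.
have cV k : \sum_(tj <- l k) c k tj ^+ 2 * sigma tj.2 ^+ 2 <= V * k%:R.
  rewrite lE mulr_natr -[X in _ *+ X]subn0 -subSS -sumr_const_nat.
  apply: ler_sum => t _; apply: ler_sum => j _; rewrite /c /= ler_wpM2r ?sqr_ge0//.
  have tr := column_stochastic_transition A_stoch t (k - t).
  rewrite ler_pXn2r ?nnegrE ?mulr_ge0 ?(ltW (tau_gt0 _))//; last exact: tr.1.
  rewrite ler_piMl ?(ltW (tau_gt0 _))//; exact: column_stochastic_le1.
have ul k : uniq (l k).
  by rewrite allpairs_uniq ?iota_uniq ?enum_uniq// => -[? ?] [].
have lD k ki : ki \in l k -> D ki.
  by case/allpairsP => -[t j] /= [+ _ ->]; rewrite mem_iota => /andP[].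
have s_neq0 (ki : nat * 'I_n) : sigma ki.2 != 0 by rewrite lt0r_neq0.
have lln := centered_sum_lln (X := fun ki => S ki.1 ki.2) S_indep
  (m := fun ki => theta ki.2) s_neq0 (fun ki => @S_normal ki.1 ki.2)
  ul lD V_gt0 cV.
apply: filterS lln => w hw.
apply: (@cvg_ratio_linear_growth R
  (fun k => trajectory A (fun t => drift t + init t) k i 0)
  (fun k => precision A tau k i) (fun k => trajectory A (noise w) k i 0) K
  (dlt * Tau / m.+1%:R) _ m) => //.
- by move=> k; exact: precision_gt0.
- by rewrite divr_gt0// mulr_gt0.
- move=> k mk; rewrite precision_trajectory.
  have := @trajectory_ge_linear _ _ A A_stoch m dlt dlt_gt0 trans_ge
    (\col_j tau j) k i.
  under eq_bigr do rewrite mxE.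
  by apply=> // j; rewrite mxE ltW.
- by move=> e e0; apply: filterS (hw e e0) => k; rewrite noiseE.
Qed.
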